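(* Let $n\ge 1$ and let $\bm{f}=(f_1,\dots,f_n)^\top:\mathbb{R}_{\max}^n\to\mathbb{R}_{\max}^n$ be a map with $\bm{f}(\bm{\varepsilon})=\bm{\varepsilon}$, so that $\bm{\varepsilon}$ is a fixed point of the difference equation $\bm{x}^{(t+1)}=\bm{f}(\bm{x}^{(t)})$, $t\in\mathbb{Z}_{\ge 0}$. Suppose that $\bm{f}$ is tropical-linearly approximated at $\bm{\varepsilon}$, and let $J_{\bm{\varepsilon}}\bm{f}\in\mathbb{R}_{\max}^{n\times n}$ be its tropical Jacobian matrix at $\bm{\varepsilon}$. If the maximum (tropical) eigenvalue of $J_{\bm{\varepsilon}}\bm{f}$ is negative, then the fixed point $\bm{\varepsilon}$ is asymptotically stable.
   Context: Tropical semiring: $\mathbb{R}_{\max}=\mathbb{R}\cup\{-\infty\}$ with $a\oplus b=\max(a,b)$, $a\otimes b=a+b$, $\varepsilon:=-\infty$ (the additive identity), and $a\oslash b=a-b$ for $b\in\mathbb{R}$ (with $\varepsilon\oslash b=\varepsilon$). Matrix products: $[A\otimes B]_{ij}=\max_k([A]_{ik}+[B]_{kj})$; scalar multiples $\alpha\otimes\bm{x}$ are entrywise. $\bm{\varepsilon}=(\varepsilon,\dots,\varepsilon)^\top\in\mathbb{R}_{\max}^n$. Distance: $d(\bm{x},\bm{y})=\max_{i}|e^{x_i}-e^{y_i}|$ on $\mathbb{R}_{\max}^n$, with $e^{\varepsilon}=0$ (also used for $n=1$); $\|\bm{x}\|:=d(\bm{x},\bm{\varepsilon})=\max_i e^{x_i}$.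 All limits are with respect to $d$. Eigenvalues: $\lambda\in\mathbb{R}_{\max}$ is an eigenvalue of $A\in\mathbb{R}_{\max}^{n\times n}$ if there is $\bm{x}\in\mathbb{R}_{\max}^n\setminus\{\bm{\varepsilon}\}$ with $A\otimes\bm{x}=\lambda\otimes\bm{x}$. Tropical linear approximation: for $g:\mathbb{R}_{\max}^n\to\mathbb{R}_{\max}$ with $g(\bm{\varepsilon})=\varepsilon$ and a row vector $\bm{a}\in\mathbb{R}_{\max}^{1\times n}$, the form $\bm{a}\otimes\bm{x}$ is a tropical linear approximation of $g$ at $\bm{\varepsilon}$ if $\lim_{\bm{x}\to\bm{\varepsilon}} d(g(\bm{x}),\bm{a}\otimes\bm{x})/\|\bm{x}\|=0$ (limit over $\bm{x}\ne\bm{\varepsilon}$). Tropical derivative and Jacobian: for $\bm{x}\in\mathbb{R}_{\max}^n$, $\bm{x}(j)$ is the vector whose $j$th entry is $x_j$ and whose other entries are $\varepsilon$. $D_{j,\bm{\varepsilon}}g:=\lim_{x_j\to\varepsilon} g(\bm{x}(j))\oslash x_j$ (over finite $x_j$), and $[J_{\bm{\varepsilon}}\bm{f}]_{ij}:=D_{j,\bm{\varepsilon}}f_i$. The map $\bm{f}$ is tropical-linearly approximated at $\bm{\varepsilon}$ if each $f_i$ has a tropical linear approximation at $\bm{\varepsilon}$; this is written $\bm{f}(\bm{x})\approx J_{\bm{\varepsilon}}\bm{f}\otimes\bm{x}$, i.e. the coefficient vector for $f_i$ is the $i$th row of $J_{\bm{\varepsilon}}\bm{f}$. Stability: the fixed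 point $\bm{\varepsilon}$ is stable if for all $\alpha>0$ there is $\delta>0$ such that $\|\bm{x}^{(0)}\|<\delta$ implies $\|\bm{x}^{(t)}\|<\alpha$ for all $t\in\mathbb{Z}_{\ge0}$; otherwise it is unstable. It is asymptotically stable if it is stable and there is $\delta'>0$ such that $\|\bm{x}^{(0)}\|<\delta'$ implies $\lim_{t\to\infty}\bm{x}^{(t)}=\bm{\varepsilon}$. *)

(* Defs.v *)
From HB Require Import structures.
From mathcomp Require Import all_boot all_order all_algebra.
From mathcomp Require Import all_classical all_reals all_analysis.

Set Implicit Arguments.
Unset Strict Implicit.
Unset Printing Implicit Defensive.

Import Order.TTheory GRing.Theory Num.Theory.
Import numFieldNormedType.Exports.

Local Open Scope classical_set_scope.
Local Open Scope ring_scope.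

Variant Rmax (R : Type) : Type := MInfty | Fin of R.

Arguments MInfty {R}.
Arguments Fin {R} _.

Section Rmax_choice.
Variable R : Type.

Definition option_of_Rmax (x : Rmax R) : option R :=
  if x is Fin r then Some r else None.

Definition Rmax_of_option (x : option R) : Rmax R :=
  if x is Some r then Fin r else MInfty.

Lemma option_of_RmaxK : cancel option_of_Rmax Rmax_of_option.
Proof. by case. Qed.

End Rmax_choice.

HB.instance Definition _ (R : choiceType) :=
  Choice.copy (Rmax R) (can_type (@option_of_RmaxK R)).
HB.instance Definition _ (R : choiceType) := isPointed.Build (Rmax R) MInfty.

Section Rmax_semiring.
Variable R : realType.
Implicit Types x y z : Rmax R.

Definition tadd x y : Rmax R :=
  match x, y with
  | MInfty, _ => y
  | _, MInfty => x
  | Fin a, Fin b => Fin (Num.max a b)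
  end.

Definition tmul x y : Rmax R :=
  match x, y with
  | Fin a, Fin b => Fin (a + b)
  | _, _ => MInfty
  end.

(* The value at y = MInfty is never used. *)
Definition tdiv x y : Rmax R :=
  match x, y with
  | Fin a, Fin b => Fin (a - b)
  | _, _ => MInfty
  end.

Definition tle x y : bool :=
  match x, y with
  | MInfty, _ => true
  | Fin _, MInfty => false
  | Fin a, Fin b => a <= b
  end.

Definition tlt x y : bool := ~~ tle y x.

Lemma taddA : associative tadd.
Proof. by case=> [|a] [|b] [|c] //=; rewrite maxA. Qed.

Lemma taddC : commutative tadd.
Proof. by case=> [|a] [|b] //=; rewrite maxC. Qed.

Lemma tadd0x : left_id MInfty tadd.
Proof. by case. Qed.

Lemma tmulA : associative tmul.
Proof. by case=> [|a] [|b] [|c] //=; rewrite addrA. Qed.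

Lemma tmulC : commutative tmul.
Proof. by case=> [|a] [|b] //=; rewrite addrC. Qed.

Lemma tmul1x : left_id (Fin 0) tmul.
Proof. by case=> //= a; rewrite add0r. Qed.

Lemma tmulDl : left_distributive tmul tadd.
Proof. by case=> [|a] [|b] [|c] //=; rewrite addr_maxl. Qed.

Lemma tmul0x : left_zero MInfty tmul.
Proof. by []. Qed.

HB.instance Definition _ := GRing.isNmodule.Build (Rmax R) taddA taddC tadd0x.

Lemma tone_neq0 : Fin 0 != 0 :> Rmax R.
Proof. by apply/eqP. Qed.

(* In this semiring 0 is -oo, 1 is the real number 0, + is max and * is real
   addition, so that mulmx and scalemx are the max-plus operations. *)
HB.instance Definition _ := GRing.Nmodule_isComNzSemiRing.Build (Rmax R)
  tmulA tmulC tmul1x tmulDl tmul0x tone_neq0.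

End Rmax_semiring.

Section Rmax_metric.
Variable R : realType.
Implicit Types x y z : Rmax R.

Definition texp x : R := if x is Fin r then expR r else 0.

Definition tdist x y : R := `|texp x - texp y|.

Lemma texp_inj : injective texp.
Proof.
case=> [|a] [|b] //= e.
- by have := expR_gt0 b; rewrite -e ltxx.
- by have := expR_gt0 a; rewrite e ltxx.
- by rewrite (expR_inj e).
Qed.

Lemma tdistxx x : tdist x x = 0.
Proof. by rewrite /tdist subrr normr0. Qed.

Lemma tdist_positivity x y : tdist x y = 0 -> x = y.
Proof. by move/normr0_eq0/subr0_eq/texp_inj. Qed.

Lemma tdist_sym x y : tdist x y = tdist y x.
Proof. exact: distrC. Qed.

Lemma tdist_triangle y x z : tdist x z <= tdist x y + tdist y z.
Proof. exact: ler_distD. Qed.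

HB.instance Definition _ := isMetric.Build R (Rmax R)
  tdistxx tdist_positivity tdist_sym tdist_triangle.

End Rmax_metric.

Section tropical_vectors.
Variables (R : realType) (n : nat).
Implicit Types (x y : 'cV[Rmax R]_n) (A : 'M[Rmax R]_n).
Implicit Types (g : 'cV[Rmax R]_n -> Rmax R).
Implicit Types (f : 'cV[Rmax R]_n -> 'cV[Rmax R]_n).

Definition veps : 'cV[Rmax R]_n := const_mx MInfty.

Definition vdist x y : R := \big[Num.max/0]_(i < n) tdist (x i 0) (y i 0).

Definition vnorm x : R := vdist x veps.

(* The topology on 'cV[Rmax R]_n used in the limits below, obtained from the
   library's matrix instance, is the one induced by vdist. *)
Lemma ball_vdist x (e : R) : ball x e = [set y | vdist x y < e].
Proof.
apply/seteqP; split=> y /=.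
  move=> [e0 xy]; apply/bigmax_ltP; split=> // i _.
  by have := xy i 0; rewrite ballEmdist.
move=> /bigmax_ltP[e0 xy]; split=> // i j.
by rewrite ballEmdist (ord1 j) /=; apply: xy.
Qed.

Definition eigenvalue_trop A (l : Rmax R) : Prop :=
  exists x, x <> veps /\ A *m x = l *: x.

Definition max_eigenvalue_trop A (l : Rmax R) : Prop :=
  eigenvalue_trop A l /\ forall m, eigenvalue_trop A m -> tle m l.

Definition trop_lin_approx g (a : 'rV[Rmax R]_n) : Prop :=
  (tdist (g x) ((a *m x) 0 0) / vnorm x) @[x --> veps^'] --> (0 : R).

Definition trop_lin_approximated f : Prop :=
  forall i, exists a, trop_lin_approx (fun x => f x i 0) a.

Definition single (j : 'I_n) (t : Rmax R) : 'cV[Rmax R]_n :=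
  \col_i (if i == j then t else MInfty).

(* The neighbourhood is punctured, so t ranges over real numbers only. *)
Definition trop_deriv g (j : 'I_n) : Rmax R :=
  lim (tdiv (g (single j t)) t @[t --> (MInfty : Rmax R)^']).

Definition trop_jacobian f : 'M[Rmax R]_n :=
  \matrix_(i, j) trop_deriv (fun x => f x i 0) j.

Definition stable f : Prop :=
  forall alpha : R, 0 < alpha -> exists delta : R, 0 < delta /\
    forall x, vnorm x < delta -> forall t, vnorm (iter t f x) < alpha.

Definition asymptotically_stable f : Prop :=
  stable f /\ exists delta : R, 0 < delta /\
    forall x, vnorm x < delta -> iter t f x @[t --> \oo] --> veps.

End tropical_vectors.

Arguments veps {R n}.

(* Main.v *)
Require Import Defs.
From mathcomp Require Import all_boot all_order all_algebra.
From mathcomp Require Import all_classical all_reals all_analysis.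
From mathcomp Require Import lra.

(** Exponentiating entrywise turns max-plus algebra into max-times algebra on
    the nonnegative reals.  The maximal cycle mean of a matrix is a tropical
    eigenvalue whenever it is not -oo: after rescaling so that it is 1, the
    maximal weights of paths ending at a vertex of a critical cycle form an
    eigenvector.  So if all eigenvalues of the Jacobian are negative, all cycle
    means are at most some r < 1 (multiplicatively), and then maximal path
    weights of the matrix rescaled by r form a positive vector w with
    J w <= r w.  The norm weighted by w is contracted by J, hence, up to the
    o(|x|) error of the approximation, also by f near the fixed point. *)

Set Implicit Arguments.
Unset Strict Implicit.
Unset Printing Implicit Defensive.

Import Order.TTheory GRing.Theory Num.Theory.
Import numFieldNormedType.Exports.

Local Open Scope classical_set_scope.
Local Open Scope ring_scope.

(** * Paths and cycles in max-times algebra *)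

Section path_weight.
Variables (R : realType) (T : finType).
Implicit Types (E : T -> T -> R) (P : pred T) (x y : T) (p q : seq T).

Fixpoint path_weight E x p : R :=
  if p is y :: q then E x y * path_weight E y q else 1.

Lemma path_weight_cat E x p q :
  path_weight E x (p ++ q) = path_weight E x p * path_weight E (last x p) q.
Proof. by elim: p x => [|y p IH] x /=; rewrite ?mul1r// IH mulrA. Qed.

Lemma path_weight_ge0 E x p :
  (forall i j, 0 <= E i j) -> 0 <= path_weight E x p.
Proof. by move=> E0; elim: p x => //= y p IH x; exact: mulr_ge0. Qed.

Lemma path_weight_div E (l : R) x p :
  path_weight (fun i j => E i j / l) x p = path_weight E x p / l ^+ size p.
Proof.
elim: p x => [|y p IH] x /=; first by rewrite expr0 divr1.
by rewrite IH exprS invfM mulrACA.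
Qed.

(** The length bound leaves finitely many cycles to control; [loop_erasure] shows that these
    suffice. *)
Definition subunital_cycles E := forall x p,
  p != [::] -> (size p <= #|T|)%N -> last x p = x -> path_weight E x p <= 1.

(** Erase loops in the tail first. If [x] occurs in the resulting simple path, the segment from [x]
    back to [x] is a cycle with distinct vertices, hence of length at most [#|T|] and weight at most
    1; cutting it out loses no weight. *)
Lemma loop_erasure E x p : (forall i j, 0 <= E i j) -> subunital_cycles E ->
  exists q, [/\ uniq (x :: q), last x q = last x p &
    path_weight E x p <= path_weight E x q].
Proof.
move=> E0 cE; elim: p x => [|y p IH] x; first by exists [::].
have [q [uq lq wq]] := IH y.
have le_q : path_weight E x (y :: p) <= path_weight E x (y :: q).
  by rewrite /= ler_wpM2l.
case: (boolP (x \in y :: q)) => xq; last first.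
  by exists (y :: q); split; [rewrite cons_uniq xq| |].
have ls : last x (y :: q) = last x (y :: p) by [].
move: (y :: q) uq le_q xq ls => s us le_s xs.
case/splitPr: s / xs us le_s => p1 p2 us le_s ls.
exists p2; split.
- by move: us; rewrite cat_uniq => /and3P[].
- by rewrite -[RHS]ls last_cat.
apply: le_trans le_s _; rewrite -cat_rcons path_weight_cat last_rcons.
rewrite -[leRHS]mul1r ler_wpM2r ?path_weight_ge0// cE ?last_rcons//.
  by case: (p1).
by move: us; rewrite -cat_rcons cat_uniq => /and3P[/card_uniqP<- _ _];
  exact: max_card.
Qed.

(** For subunital cycles this is the Kleene star of [E] applied to the indicator vector of [P].
    Bounding the length makes the index type finite. *)
Definition max_path_weight E (P : pred T) x : R :=
  \big[Num.max/0]_(p : #|T|.-bseq T | P (last x p)) path_weight E x p.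

Lemma max_path_weight_ge0 E P x : 0 <= max_path_weight E P x.
Proof. exact: bigmax_ge_id. Qed.

Lemma path_weight_le_max E P x p : (forall i j, 0 <= E i j) ->
  subunital_cycles E -> P (last x p) ->
  path_weight E x p <= max_path_weight E P x.
Proof.
move=> E0 cE Pp; have [q [uq lq wq]] := loop_erasure x p E0 cE.
apply: le_trans wq _.
have sq : (size q <= #|T|)%N.
  by move: uq => /andP[_ /card_uniqP<-]; exact: max_card.
have /= := @le_bigmax_cond _ _ _ 0 (Bseq sq)
  (fun p : #|T|.-bseq T => P (last x p))
  (fun p : #|T|.-bseq T => path_weight E x p).
by apply; rewrite lq.
Qed.

(** An edge prepended to a path from [y] gives a path from [x], possibly too long for the maximum,
    but [path_weight_le_max] bounds every length. *)
Lemma max_path_weight_super E P x y : (forall i j, 0 <= E i j) ->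
  subunital_cycles E ->
  E x y * max_path_weight E P y <= max_path_weight E P x.
Proof.
move=> E0 cE; have := E0 x y; rewrite le_eqVlt => /orP[/eqP<-|Exy].
  by rewrite mul0r max_path_weight_ge0.
rewrite mulrC -ler_pdivlMr//; apply/bigmax_leP; split => [|p Pp].
  by rewrite divr_ge0// max_path_weight_ge0.
rewrite ler_pdivlMr// mulrC.
exact: (@path_weight_le_max E P x (y :: p)).
Qed.

(** Split off the first edge of each path. Only the empty path at [c] has none, and the cycle [p],
    also of weight 1, replaces it. *)
Lemma max_path_weight_sub E c p x : (forall i j, 0 <= E i j) ->
  subunital_cycles E -> p != [::] -> last c p = c -> path_weight E c p = 1 ->
  max_path_weight E (pred1 c) x <=
  \big[Num.max/0]_y (E x y * max_path_weight E (pred1 c) y).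
Proof.
move=> E0 cE; case: p => // z p _ lp wp.
have step y q : last y q = c -> E x y * path_weight E y q <=
    \big[Num.max/0]_y (E x y * max_path_weight E (pred1 c) y).
  move=> lq; apply: le_trans (le_bigmax _ _ y); rewrite ler_wpM2l//.
  by apply: path_weight_le_max => //=; rewrite lq.
apply/bigmax_leP; split => [|[[|y q] sq] /= /eqP lq]; first exact: bigmax_ge_id.
  by subst c; rewrite -wp; exact: step.
exact: step.
Qed.

(** A geometric mean over the edges: the exponential of the max-plus cycle mean. *)
Definition cycle_mean E x p : R := path_weight E x p `^ (size p)%:R^-1.

Lemma cycle_meanK E x p : (forall i j, 0 <= E i j) -> p != [::] ->
  cycle_mean E x p ^+ size p = path_weight E x p.
Proof.
move=> E0 p0; rewrite -powR_mulrn ?powR_ge0// -powRrM mulVf ?powRr1//.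
  exact: path_weight_ge0.
by rewrite pnatr_eq0 size_eq0.
Qed.

Lemma subeigen_or_eigen E : (forall i j, 0 <= E i j) ->
  (exists (r : R) (w : T -> R), [/\ 0 < r < 1, forall i, 1 <= w i &
     forall i j, E i j * w j <= r * w i]) \/
  (exists (l : R) (v : T -> R), [/\ 1 <= l, forall i, 0 <= v i, exists i, 0 < v i &
     forall i, \big[Num.max/0]_j (E i j * v j) = l * v i]).
Proof.
move=> E0.
pose cyc := fun z : T * #|T|.-bseq T =>
  (z.2 != [::] :> seq T) && (last z.1 z.2 == z.1).
(* The floor 1/2 keeps [r] positive when every cycle has weight 0. *)
pose r := \big[Num.max/2^-1]_(z | cyc z) cycle_mean E z.1 z.2.
have r_ge : 2^-1 <= r by exact: bigmax_ge_id.
have r0 : 0 < r by apply: lt_le_trans r_ge; rewrite invr_gt0.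
pose F i j := E i j / r.
have F0 i j : 0 <= F i j by rewrite divr_ge0// ltW.
have cF : subunital_cycles F.
  move=> x p p0 sp lp.
  rewrite path_weight_div ler_pdivrMr ?exprn_gt0// mul1r -cycle_meanK//.
  rewrite lerXn2r ?nnegrE ?powR_ge0 ?(ltW r0)//.
  have cp : cyc (x, Bseq sp) by rewrite /cyc /= p0 lp eqxx.
  exact: (@le_bigmax_cond _ _ _ 2^-1 _ cyc (fun z => cycle_mean E z.1 z.2) cp).
have FE i j (a : R) : E i j * a = r * (F i j * a).
  by rewrite mulrA /F (mulrC r) divfK ?gt_eqF.
case: (ltP r 1) => r1; [left|right].
  exists r, (max_path_weight F predT); rewrite r0 r1; split => // [i|i j].
    (* The empty path has weight 1. *)
    exact: (@path_weight_le_max F predT i [::]).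
  by rewrite FE ler_wpM2l ?max_path_weight_super// ltW.
(* Since [r] is at least 1, it exceeds the floor 1/2, so some critical cycle attains it. *)
have [[c p] /= /andP[/= p0 /eqP lp] rE] :
    exists2 z, cyc z & r = cycle_mean E z.1 z.2.
  have [z cz lz] : exists2 z, cyc z & 2^-1 < cycle_mean E z.1 z.2.
    apply: contrapT => nz.
    suff : r <= 2^-1 by move=> rle; lra.
    apply/bigmax_leP; split=> // z cz; rewrite leNgt; apply/negP => lz.
    by apply: nz; exists z.
  case: (@arg_maxP _ _ _ z cyc (fun z => cycle_mean E z.1 z.2)) => // y cy my.
  exists y => //; apply/le_anti/andP; split; last exact: le_bigmax_cond.
  apply/bigmax_leP; split => [|u cu]; last exact: my.
  exact: le_trans (ltW lz) (my _ cz).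
have wp : path_weight F c p = 1.
  by rewrite path_weight_div -cycle_meanK// rE divff// -rE expf_neq0// gt_eqF.
exists r, (max_path_weight F (pred1 c)); split => // [i||i].
- exact: max_path_weight_ge0.
- exists c; apply: lt_le_trans ltr01 _.
  exact: (@path_weight_le_max F (pred1 c) c [::] F0 cF (eqxx c)).
under eq_bigr do rewrite FE.
apply/le_anti/andP; split.
  apply/bigmax_leP; split => [|j _].
    by rewrite mulr_ge0 ?max_path_weight_ge0// ltW.
  by rewrite ler_wpM2l ?max_path_weight_super// ltW.
rewrite mulrC -ler_pdivlMr//.
apply: le_trans (max_path_weight_sub i F0 cF p0 lp wp) _.
apply/bigmax_leP; split => [|j _].
  by rewrite divr_ge0 ?bigmax_ge_id// ltW.
rewrite ler_pdivlMr// mulrC.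
exact: (le_bigmax _ (fun j => r * (F i j * max_path_weight F (pred1 c) j))).
Qed.

End path_weight.

(** * The exponential as a morphism from max-plus to max-times *)

Section Rmax_theory.
Variable R : realType.
Implicit Types x y : Rmax R.

Lemma texp_ge0 x : 0 <= texp x.
Proof. by case: x => //= r; exact: expR_ge0. Qed.

Lemma texpD x y : texp (x + y) = Num.max (texp x) (texp y).
Proof.
case: x y => [|a] [|b]; rewrite [_ + _]/= /=.
- by rewrite maxxx.
- by rewrite max_r ?expR_ge0.
- by rewrite max_l ?expR_ge0.
- by rewrite /Num.max ltr_expR; case: ifP.
Qed.

Lemma texpM x y : texp (x * y) = texp x * texp y.
Proof.
case: x y => [|a] [|b]; rewrite [_ * _]/= /= ?mul0r ?mulr0//.
exact: expRD.
Qed.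

Lemma texp_mulmx m n p (A : 'M[Rmax R]_(m, n)) (B : 'M[Rmax R]_(n, p)) i k :
  texp ((A *m B) i k) = \big[Num.max/0]_j (texp (A i j) * texp (B j k)).
Proof.
rewrite mxE (big_morph _ texpD (erefl : texp 0 = 0)).
by apply: eq_bigr => j _; rewrite texpM.
Qed.

Lemma ler_texp x y : tle x y -> texp x <= texp y.
Proof.
by case: x y => [|a] [|b] //= ab; rewrite ?expR_ge0 ?ler_expR.
Qed.

Lemma ltr_texp x y : tlt x y -> texp x < texp y.
Proof.
case: x y => [|a] [|b] //=; first by rewrite expR_gt0.
by rewrite /tlt /= -ltNge ltr_expR.
Qed.

(** The test is there for 0, which must go to [MInfty] whereas [ln] returns a real number. *)
Definition tln (r : R) : Rmax R := if 0 < r then Fin (ln r) else MInfty.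

Lemma tlnK r : 0 <= r -> texp (tln r) = r.
Proof.
rewrite /tln; case: ifPn => [r0 _|]; first by rewrite /= lnK.
by rewrite -leNgt => r0 r1; apply/le_anti; rewrite r0 r1.
Qed.

Lemma texp_div x (t : R) : texp (tdiv x (Fin t)) = texp x / expR t.
Proof. by case: x => [|a] /=; rewrite ?mul0r// expRB. Qed.

End Rmax_theory.

(** * Linear approximation, the Jacobian and its eigenvalues *)

Section approximation.
Variables (R : realType) (n : nat).
Implicit Types (x : 'cV[Rmax R]_n) (g : 'cV[Rmax R]_n -> Rmax R).

Lemma vdistC x y : vdist x y = vdist y x.
Proof. by apply: eq_bigr => i _; exact: tdist_sym. Qed.

Lemma vnormE x : vnorm x = \big[Num.max/0]_i texp (x i 0).
Proof.
apply: eq_bigr => i _.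
by rewrite mxE /tdist /= subr0 ger0_norm// texp_ge0.
Qed.

Lemma vnorm_ge0 x : 0 <= vnorm x. Proof. exact: bigmax_ge_id. Qed.

Lemma vnorm_gt0 x : x <> veps -> 0 < vnorm x.
Proof.
move=> x0; rewrite lt_neqAle vnorm_ge0 andbT; apply/eqP => xn.
apply: x0; apply/matrixP => i j; rewrite mxE (ord1 j).
apply: texp_inj; apply/le_anti; rewrite texp_ge0 andbT /= xn vnormE.
exact: (le_bigmax _ (fun i => texp (x i 0))).
Qed.

Lemma trop_lin_approx_lt g a (eta : R) : trop_lin_approx g a -> 0 < eta ->
  exists2 delta, 0 < delta & forall x, x <> veps -> vnorm x < delta ->
    tdist (g x) ((a *m x) 0 0) < eta * vnorm x.
Proof.
move=> ga eta0.
have /cvgrPdist_lt /(_ _ eta0) := ga.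
move/nbhs_ballP => [d /= d0 H]; exists d => // x x0 xd.
have := H x; rewrite ball_vdist /= vdistC => /(_ xd).
move=> /(_ (introN eqP x0)).
rewrite sub0r normrN ger0_norm; last by rewrite divr_ge0 ?vnorm_ge0 ?normr_ge0.
by rewrite ltr_pdivrMr ?vnorm_gt0.
Qed.

(** On [single j (Fin t)] the norm is [expR t] and the linear form is [a 0 j] times [Fin t], so the
    relative error is exactly the distance from the difference quotient to [a 0 j]. *)
Lemma trop_deriv_lin_approx g a j : trop_lin_approx g a ->
  trop_deriv g j = a 0 j.
Proof.
move=> ga.
(* Uniqueness of the limit needs finite points arbitrarily close to [MInfty]. *)
have PF : ProperFilter ((MInfty : Rmax R)^').
  apply: Build_ProperFilter_ex => A /nbhs_ballP[d /= d0 dA].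
  exists (Fin (ln (d / 2))); apply: dA => //.
  rewrite ballEmdist /= /mdist /= /tdist /= sub0r normrN ger0_norm ?expR_ge0//.
  by rewrite lnK ?posrE ?divr_gt0// ltr_pdivrMr// ltr_pMr// ltr1n.
rewrite /trop_deriv; apply: cvg_lim; first exact: metric_hausdorff.
apply/cvg_ballP => e e0.
have [d d0 gd] := trop_lin_approx_lt ga e0.
apply/nbhs_ballP; exists d => //= -[|t]; first by move=> _ /eqP.
rewrite ballEmdist /= => td _.
have single_t i : single j (Fin t) i 0 = if i == j then Fin t else MInfty.
  by rewrite mxE.
have nt : vnorm (single j (Fin t)) = expR t.
  rewrite vnormE; apply/le_anti/andP; split.
    apply/bigmax_leP; split => [|i _]; first exact: expR_ge0.
    by rewrite single_t; case: ifP => //= _; exact: expR_ge0.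
  have := le_bigmax 0 (fun i => texp (single j (Fin t) i 0)) j.
  by rewrite /= single_t eqxx.
have := gd (single j (Fin t)); rewrite nt.
have at_ : texp ((a *m single j (Fin t)) 0 0) = texp (a 0 j) * expR t.
  rewrite texp_mulmx; apply/le_anti/andP; split.
    apply/bigmax_leP; split => [|i _].
      by rewrite mulr_ge0 ?texp_ge0 ?expR_ge0.
    rewrite single_t; case: eqP => [->//|_].
    by rewrite mulr0 mulr_ge0 ?texp_ge0 ?expR_ge0.
  have := le_bigmax 0 (fun i => texp (a 0 i) * texp (single j (Fin t) i 0)) j.
  by rewrite /= single_t eqxx.
rewrite /tdist at_ => H.
rewrite ballEmdist /= [mdist _ _]tdist_sym /tdist texp_div.
rewrite -(ltr_pM2r (expR_gt0 t)) -[X in _ * X < _](gtr0_norm (expR_gt0 t)) -normrM mulrBl.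
rewrite divfK ?gt_eqF ?expR_gt0//; apply: H.
  move=> /(congr1 (fun x : 'cV_n => x j 0)).
  by rewrite single_t eqxx mxE.
by move: td; rewrite /mdist /= /tdist /= sub0r normrN ger0_norm ?expR_ge0.
Qed.

Lemma trop_jacobianP f : trop_lin_approximated f -> forall i,
  trop_lin_approx (fun x : 'cV[Rmax R]_n => f x i 0) (row i (trop_jacobian f)).
Proof.
move=> hf i; have [a ga] := hf i; suff -> : row i (trop_jacobian f) = a by [].
by apply/rowP => j; rewrite !mxE (trop_deriv_lin_approx j ga).
Qed.

Lemma lin_approximated_le f (eta : R) : f veps = veps ->
  trop_lin_approximated f -> 0 < eta ->
  exists2 delta, 0 < delta & forall x, vnorm x < delta -> forall i,
    texp (f x i 0) <=
    \big[Num.max/0]_j (texp (trop_jacobian f i j) * texp (x j 0)) +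
    eta * vnorm x.
Proof.
move=> f0 hf eta0.
(* Choice gives a radius for each coordinate, so that their minimum can be taken. *)
have dP i := cid2 (trop_lin_approx_lt (trop_jacobianP hf i) eta0).
pose d i := s2val (dP i).
exists (\big[Num.min/1]_i d i).
  by apply/bigmin_gtP; split => // i _; exact: (s2valP (dP i)).
move=> x /bigmin_gtP[_ xd] i.
have [->|x0] := pselect (x = veps).
  rewrite f0 mxE /= addr_ge0 ?mulr_ge0 ?vnorm_ge0 ?(ltW eta0)//.
  exact: bigmax_ge_id.
have := s2valP' (dP i) x x0 (xd i isT); rewrite /tdist texp_mulmx.
under eq_bigr do rewrite mxE.
by move=> H; have := ler_norm (texp (f x i 0) - \big[Num.max/0]_j
  (texp (trop_jacobian f i j) * texp (x j 0))); lra.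
Qed.

(** The other alternative of [subeigen_or_eigen] would, through [tln], make [tln m] a nonnegative
    eigenvalue above [l]. *)
Lemma subeigen_of_neg (A : 'M[Rmax R]_n) l : max_eigenvalue_trop A l ->
  tlt l (Fin 0) -> exists (r : R) (w : 'I_n -> R), [/\ 0 < r < 1,
    forall i, 1 <= w i & forall i j, texp (A i j) * w j <= r * w i].
Proof.
move=> [_ lmax] l0.
have [//|[m [v [m1 v0 [i vi] Av]]]] :=
  subeigen_or_eigen (fun i j : 'I_n => texp_ge0 (A i j)).
have /lmax/ler_texp : eigenvalue_trop A (tln m).
  exists (\col_i tln (v i)); split.
    move=> /(congr1 (fun x : 'cV_n => texp (x i 0))).
    by rewrite !mxE tlnK//= => e; rewrite e ltxx in vi.
  apply/colP => k; apply: texp_inj; rewrite texp_mulmx mxE texpM mxE !tlnK//.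
    by rewrite -Av; apply: eq_bigr => j _; rewrite mxE tlnK.
  exact: le_trans ler01 m1.
have := ltr_texp l0; rewrite /= expR0 tlnK; last exact: le_trans ler01 m1.
by move=> l1 ml; have := le_lt_trans (le_trans m1 ml) l1; rewrite ltxx.
Qed.

End approximation.

(** * Contraction of the weighted norm *)

Theorem theorem4p1 (R : realType) (n : nat) (hn : (1 <= n)%N)
  (f : 'cV[Rmax R]_n -> 'cV[Rmax R]_n)
  (hf0 : f veps = veps)
  (hf : trop_lin_approximated f)
  (lambda : Rmax R)
  (hlambda : max_eigenvalue_trop (trop_jacobian f) lambda)
  (hneg : tlt lambda (Fin 0)) :
  asymptotically_stable f.
Proof.
have [r [w [/andP[r0 r1] w1 Aw]]] := subeigen_of_neg hlambda hneg.
have w0 i : 0 < w i by exact: lt_le_trans ltr01 (w1 i).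
pose W : R := \big[Num.max/1]_i w i.
have W1 : 1 <= W by exact: bigmax_ge_id.
have W0 : 0 < W by exact: lt_le_trans ltr01 W1.
pose N (x : 'cV[Rmax R]_n) := \big[Num.max/0]_i (texp (x i 0) / w i).
have N0 x : 0 <= N x by exact: bigmax_ge_id.
have leN (x : 'cV[Rmax R]_n) i : texp (x i 0) <= w i * N x.
  rewrite mulrC -ler_pdivrMr//.
  exact: (le_bigmax _ (fun i => texp (x i 0) / w i)).
have N_le (x : 'cV[Rmax R]_n) : N x <= vnorm x.
  apply/bigmax_leP; split => [|i _]; first exact: vnorm_ge0.
  rewrite ler_pdivrMr//; apply: le_trans (_ : vnorm x <= _).
    by rewrite vnormE; exact: (le_bigmax _ (fun i => texp (x i 0))).
  by rewrite ler_peMr ?vnorm_ge0.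
have le_N (x : 'cV[Rmax R]_n) : vnorm x <= W * N x.
  rewrite vnormE; apply/bigmax_leP; split => [|i _].
    by rewrite mulr_ge0// ltW.
  by apply: le_trans (leN x i) _; rewrite ler_wpM2r//; exact: le_bigmax.
(* As [vnorm x <= W * N x], the error [eta * vnorm x] is at most [(1 - r) / 2 * N x], which raises
   the contraction factor from [r] only to [q], the midpoint of [r] and 1. *)
pose eta := (1 - r) / (2 * W).
have eta0 : 0 < eta by rewrite divr_gt0 ?mulr_gt0// subr_gt0.
pose q := (1 + r) / 2.
have q0 : 0 <= q by rewrite /q; lra.
have q1 : q < 1 by rewrite /q; lra.
have [d d0 fd] := lin_approximated_le hf0 hf eta0.
(* The region is a ball of [N], not of [vnorm], so that [f] maps it into itself and the bound can be
   iterated. *)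
have contr x : W * N x < d -> N (f x) <= q * N x.
  move=> xd; apply/bigmax_leP; split => [|i _]; first by rewrite mulr_ge0.
  rewrite ler_pdivrMr//; apply: le_trans (fd x (le_lt_trans (le_N x) xd) i) _.
  have -> : q * N x * w i = r * w i * N x + (1 - r) / 2 * N x * w i.
    by rewrite /q; lra.
  apply: lerD.
    apply/bigmax_leP; split => [|j _]; first by rewrite !mulr_ge0// ltW.
    apply: le_trans (_ : texp (trop_jacobian f i j) * (w j * N x) <= _).
      by rewrite ler_wpM2l ?texp_ge0.
    by rewrite mulrA ler_wpM2r.
  apply: le_trans (_ : eta * (W * N x) <= _); first by rewrite ler_wpM2l// ltW.
  have -> : eta * (W * N x) = (1 - r) / 2 * N x.
    by rewrite mulrA /eta invfM -[_ * W]mulrA -[_ * W]mulrA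
      mulVf ?gt_eqF// mulr1.
  (* Here [1 <= w i] absorbs the unweighted error. *)
  by rewrite ler_peMr// mulr_ge0//; lra.
have iterN x t : W * N x < d -> N (iter t f x) <= q ^+ t * N x.
  move=> xd; elim: t => [|t IH]; first by rewrite expr0 mul1r.
  rewrite iterS exprS -mulrA; apply: le_trans (contr _ _) _.
    apply: le_lt_trans xd; rewrite ler_pM2l//; apply: le_trans IH _.
    by rewrite ler_piMl// exprn_ile1// ltW.
  by rewrite ler_wpM2l.
have WN x e : vnorm x < e / W -> W * N x < e.
  by move=> xe; rewrite mulrC -ltr_pdivlMr//; exact: le_lt_trans xe.
split.
  move=> alpha alpha0; exists (Num.min alpha d / W); split.
    by rewrite divr_gt0// lt_min alpha0.
  move=> x /WN; rewrite lt_min => /andP[xa xd] t.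
  apply: le_lt_trans (le_N _) (le_lt_trans _ xa); rewrite ler_pM2l//.
  by apply: le_trans (iterN x t xd) _; rewrite ler_piMl// exprn_ile1// ltW.
exists (d / W); split => [|x /WN xd]; first exact: divr_gt0.
apply/cvg_ballP => e e0.
(* This sequence dominates [W * N (iter t f x)] because [W * N x < d]. *)
have : geometric d q k @[k --> \oo] --> 0.
  by apply: cvg_geometric; rewrite ger0_norm.
move=> /cvgrPdist_lt /(_ _ e0); apply: filterS => t.
rewrite ball_vdist /= vdistC sub0r normrN => H.
apply: le_lt_trans (le_N _) (le_lt_trans _ (le_lt_trans (ler_norm _) H)).
apply: le_trans (_ : W * (q ^+ t * N x) <= _); first by rewrite ler_pM2l// iterN.
by rewrite mulrCA mulrC ler_wpM2r ?exprn_ge0// ltW.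
Qed.
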